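(* Let $C$ be a commutative ring, $n\ge1$, and let $A=C\{a_1,\dots,a_\ell\}$ be an affine PI-algebra over $C$ satisfying the Capelli identity $\mathrm{Cap}_{n+1}$. Then $\mathrm{Obst}_n(A)\cdot(\mathcal{CAP}_n(A))^2=0$.
   Context: $\mathrm{Cap}_m(x_1,\dots,x_m;y_1,\dots,y_m)=\sum_{\pi\in S_m}\operatorname{sgn}(\pi)x_{\pi(1)}y_1\cdots x_{\pi(m)}y_m$. $\mathcal{CAP}_n(A)$ is the ideal of $A$ generated by all evaluations of $\mathrm{Cap}_n$ on elements of $A$. For each $a\in A$ let $\xi_{1,a},\dots,\xi_{n,a}$ be new commuting (central) indeterminates, and let $A[\xi_{n,A}]=A[\xi_{1,a},\dots,\xi_{n,a}\mid a\in A]$ be the polynomial algebra over $A$ in all of these. Let $I_{n,A}$ be the ideal of $A[\xi_{n,A}]$ generated by the elements $a^n+\xi_{1,a}a^{n-1}+\cdots+\xi_{n,a}$, $a\in A$. Define $\mathrm{Obst}_n(A)=A\cap I_{n,A}$, viewing $A\subseteq A[\xi_{n,A}]$. *)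

(* Defs.v *)
From HB Require Import structures.
From mathcomp Require Import all_boot all_order all_algebra all_fingroup.
From mathcomp.multinomials Require Import monalg.

Set Implicit Arguments.
Unset Strict Implicit.
Unset Printing Implicit Defensive.

Import GRing.Theory.
Local Open Scope ring_scope.

Definition Cap (R : ringType) (m : nat) (x y : 'I_m -> R) : R :=
  \sum_(s : 'S_m) (-1) ^+ s * \prod_(i < m) (x (s i) * y i).

Inductive ideal_gen (R : ringType) (S : R -> Prop) : R -> Prop :=
| ig_base x : S x -> ideal_gen S x
| ig_0 : ideal_gen S 0
| ig_add x y : ideal_gen S x -> ideal_gen S y -> ideal_gen S (x + y)
| ig_mull a x : ideal_gen S x -> ideal_gen S (a * x)
| ig_mulr x a : ideal_gen S x -> ideal_gen S (x * a).

Definition CAP (R : ringType) (n : nat) : R -> Prop :=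
  ideal_gen (fun z => exists x y : 'I_n -> R, z = Cap x y).

Inductive subalg_gen (C : comRingType) (A : algType C) (s : seq A) : A -> Prop :=
| sg_gen x : x \in s -> subalg_gen s x
| sg_1 : subalg_gen s 1
| sg_add x y : subalg_gen s x -> subalg_gen s y -> subalg_gen s (x + y)
| sg_mul x y : subalg_gen s x -> subalg_gen s y -> subalg_gen s (x * y)
| sg_scale (c : C) x : subalg_gen s x -> subalg_gen s (c *: x).

Definition affine (C : comRingType) (A : algType C) : Prop :=
  exists s : seq A, forall x : A, subalg_gen s x.

(* A[xi_{n,A}]: polynomial algebra over A in commuting central indeterminates
   xi_{i,a}, a in A, 1 <= i <= n; the index (a, i : 'I_n) stands for xi_{i+1,a}. *)
Definition xiAlg (R : ringType) (n : nat) :=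
  {malg R[{cmonom (R * 'I_n)%type}]}.

Definition xi (R : ringType) (n : nat) (a : R) (i : 'I_n) : xiAlg R n :=
  << ucm (a, i) >>.

Definition xi_poly (R : ringType) (n : nat) (a : R) : xiAlg R n :=
  (a ^+ n)%:MP + \sum_(i < n) xi a i * (a ^+ (n - i.+1))%:MP.

Definition Obst (R : ringType) (n : nat) (a : R) : Prop :=
  ideal_gen (fun p : xiAlg R n => exists b : R, p = xi_poly n b) a%:MP.

(* Main.v *)
Require Import Defs.
From HB Require Import structures.
From mathcomp Require Import all_boot all_order all_algebra all_fingroup.
From mathcomp Require Import finmap.
From mathcomp.multinomials Require Import monalg.

(**
Because A satisfies Cap_{n+1}, the alternating form
alt_form v z = sum_s sgn(s) prod_i v_i z_(s i) behaves like an n x n determinant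
in the columns z. Three facts about determinants survive over any commutative
ring C:
- the columns of a product of two forms can be exchanged,
  alt_form v z * alt_form w x = alt_form v x * alt_form w z;
- replacing k of the columns z_i by a z_i, in all possible ways, has the same
  effect on either factor of such a product (it plays the role of multiplication
  by the k-th coefficient of the characteristic polynomial of a), and these
  operations commute with each other on products;
- Cramer's rule, hence a Cayley-Hamilton identity for a acting on the left of a
  form.
So A[xi] acts on the functions x |-> c * alt_form w x, with c in the span of the
forms, by letting xi_{k,a} be the signed k-th operation on x. The generators of
I_{n,A} act as 0, whereas an element of A acts by left multiplication; hence
Obst_n(A) kills all products of two forms.
*)

Set Implicit Arguments.
Unset Strict Implicit.
Unset Printing Implicit Defensive.
Import GRing.Theory.
Local Open Scope ring_scope.

(** The first hypothesis makes [K] a union of left cosets of [H]. The part of the sum lying in the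
    coset of [g0] is the vanishing sum over [H], translated by [g0]. *)
Lemma sum_coset0 (gT : finGroupType) (V : zmodType) (H : {group gT})
    (K : pred gT) (f : gT -> V) :
  (forall g h, h \in H -> K (g * h)%g = K g) ->
  (forall g, \sum_(h in H) f (g * h)%g = 0) -> \sum_(g | K g) f g = 0.
Proof.
move=> KH f0; rewrite (partition_big (fun g => g *: H)%g predT) //=.
apply: big1 => C _; case: (pickP (fun g => K g && (g *: H == C)%g)); last first.
  by move=> E; rewrite big_pred0.
move=> g0 /andP[Kg0 /eqP <-].
rewrite -[RHS](f0 g0) [RHS](reindex_onto (fun g => g0^-1 * g)%g (fun h => g0 * h)%g).
  apply: eq_big => [g|g _]; last by rewrite mulKVg.
  rewrite mulKVg eqxx andbT -mem_lcoset.
  apply/andP/idP => [[_ /eqP <-]|gH]; first by rewrite lcoset_refl.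
  split; last exact/eqP/lcoset_eqP.
  by rewrite -(mulKVg g0 g) KH // -mem_lcoset.
by move=> h _; rewrite mulKg.
Qed.

(** * Permutations extended along an injection *)

Section ExtendPerm.
Variables (m : nat) (T : finType) (iota : 'I_m -> T).
Hypothesis iota_inj : injective iota.

Definition extend_fun (s : 'S_m) (t : T) : T :=
  if [pick j | iota j == t] is Some j then iota (s j) else t.

Lemma extend_fun_in s j : extend_fun s (iota j) = iota (s j).
Proof.
rewrite /extend_fun; case: pickP => [k /eqP/iota_inj -> //|/(_ j)].
by rewrite eqxx.
Qed.

Lemma extend_fun_out s t : t \notin codom iota -> extend_fun s t = t.
Proof.
rewrite /extend_fun; case: pickP => // k /eqP <- /negP[]; exact: codom_f.
Qed.

Lemma extend_funM s1 s2 t :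
  extend_fun (s1 * s2)%g t = extend_fun s2 (extend_fun s1 t).
Proof.
have [/codomP[j ->]|tN] := boolP (t \in codom iota).
  by rewrite !extend_fun_in permM.
by rewrite !extend_fun_out.
Qed.

Lemma extend_fun1 t : extend_fun 1%g t = t.
Proof.
have [/codomP[j ->]|tN] := boolP (t \in codom iota).
  by rewrite extend_fun_in perm1.
by rewrite extend_fun_out.
Qed.

Lemma extend_funK s : cancel (extend_fun s) (extend_fun s^-1%g).
Proof. by move=> t; rewrite -extend_funM mulgV extend_fun1. Qed.

Definition extend_perm (s : 'S_m) : {perm T} := perm (can_inj (extend_funK s)).

Lemma extend_perm_in s j : extend_perm s (iota j) = iota (s j).
Proof. by rewrite permE extend_fun_in. Qed.

Lemma extend_perm_out s t : t \notin codom iota -> extend_perm s t = t.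
Proof. by rewrite permE; apply: extend_fun_out. Qed.

Lemma extend_permM : {morph extend_perm : s1 s2 / (s1 * s2)%g >-> (s1 * s2)%g}.
Proof. by move=> s1 s2; apply/permP => t; rewrite permM !permE extend_funM. Qed.

Lemma extend_perm_inj : injective extend_perm.
Proof.
move=> s1 s2 e; apply/permP => j; apply: iota_inj.
by rewrite -!extend_perm_in e.
Qed.

Canonical extend_morphism :=
  Morphism (D := [set: 'S_m]) (fun s1 s2 _ _ => extend_permM s1 s2).

(** Extension is multiplicative and sends the transposition of a and b to that of [iota a] and
    [iota b], so a factorization into transpositions is preserved. *)
Lemma odd_extend_perm s : extend_perm s = s :> bool.
Proof.
case: (prod_tpermP s) => ts -> /allP tsP; elim: ts tsP => [_|[a b] ts IH tsP].
  rewrite !big_nil odd_perm1; have ->: extend_perm 1 = 1%g; last exact: odd_perm1.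
  by apply/permP => t; rewrite permE extend_fun1 perm1.
have /= ab : dpair (a, b) by apply: tsP; rewrite mem_head.
rewrite !big_cons extend_permM !odd_permM IH => [/=|p pts]; last first.
  by apply: tsP; rewrite inE pts orbT.
congr (_ (+) _); suff -> : extend_perm (tperm a b) = tperm (iota a) (iota b).
  by rewrite !odd_tperm (inj_eq iota_inj).
apply/permP => t; have [/codomP[j ->]|tN] := boolP (t \in codom iota).
  by rewrite extend_perm_in inj_tperm.
rewrite extend_perm_out // tpermD //; apply: contraNneq tN => <-; exact: codom_f.
Qed.

Lemma extend_perm_onto (p : {perm T}) :
  (forall j, p (iota j) \in codom iota) ->
  exists s : 'S_m, forall j, p (iota j) = iota (s j).
Proof.
move=> pP; pose s j := iinv (pP j).
have sE j : iota (s j) = p (iota j) by rewrite /s f_iinv.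
have s_inj : injective s.
  by move=> j k e; apply/iota_inj/(@perm_inj _ p); rewrite -!sE e.
by exists (perm s_inj) => j; rewrite permE sE.
Qed.

End ExtendPerm.

(** * Alternating forms, and alternation of some letters of a longer word *)

(** A Capelli polynomial whose words start with a fixed letter instead of an alternating one. A left
    factor can then be absorbed into the first [v i]. *)
Definition alt_form (R : pzRingType) (n : nat) (v z : 'I_n -> R) : R :=
  \sum_(s : 'S_n) (-1) ^+ s * \prod_(i < n) (v i * z (s i)).

Section Word.
Variables (R : pzRingType) (T : eqType) (c : T -> R).

Lemma word_extract (D : pred T) (t0 : T -> R) (s : seq T) :
  exists u e, size u = size (filter D s) /\
    forall t, (forall p, ~~ D p -> t p = t0 p) ->
    \prod_(p <- s) (c p * t p) =
    (\prod_(q <- zip u (filter D s)) (q.1 * t q.2)) * e.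
Proof.
elim: s => [|p s [u [e [su uE]]]].
  by exists [::], 1; split=> // t _; rewrite !big_nil mulr1.
case Dp: (D p) => /=; rewrite Dp; last first.
  case: u su uE => [|a u]; case: (filter D s) => [|q r] //= su uE.
    exists [::], (c p * t0 p * e); split=> // t tE.
    by rewrite big_cons uE // !big_nil !mul1r tE ?Dp.
  exists (c p * t0 p * a :: u), e; split=> // t tE.
  by rewrite /= !big_cons /= uE // big_cons /= tE ?Dp // !mulrA.
exists (c p :: u), e; split=> [|t tE]; first by rewrite /= su.
by rewrite /= !big_cons /= uE // !mulrA.
Qed.

End Word.

(** Once the letters outside the image of [iota] are absorbed into coefficients, the sum is, up to
    sign, an alternating form times a tail. *)
Lemma alt_word (R : pzRingType) (n : nat) (T : finType) (c t : T -> R)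
    (s : seq T) (iota : 'I_n -> T) (iota_inj : injective iota) :
  (forall v z : 'I_n -> R, alt_form v z = 0) ->
  uniq s -> (forall p, p \in s) ->
  \sum_(h : 'S_n) (-1) ^+ h *
    \prod_(p <- s) (c p * t (extend_perm iota_inj h p)) = 0.
Proof.
move=> F0 us sT.
case: (word_extract c [in codom iota] t s) => u [e [su uE]].
set r := filter _ s in su uE.
have rP : perm_eq r (mktuple iota).
  apply: uniq_perm; rewrite ?filter_uniq //.
    by rewrite map_inj_uniq ?enum_uniq.
  by move=> p; rewrite mem_filter sT andbT.
(* The places of [iota] may occur in [s] in another order. [th] records that order and is removed
   below by reindexing, at the cost of its sign. *)
have [th rE] := tuple_permP rP.
have sr : size r = n by rewrite rE size_map size_enum_ord.
have rn (j : 'I_n) : nth (iota j) r j = iota (th j).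
  rewrite rE (nth_map j) ?size_enum_ord // nth_ord_enum.
  by rewrite tnth_mktuple.
transitivity (\sum_(h : 'S_n) (-1) ^+ h *
    ((\prod_(j < n) (nth 0 u j * t (iota (h (th j))))) * e)).
  apply: eq_bigr => h _; congr (_ * _).
  rewrite (uE (fun p => t (extend_perm iota_inj h p))); last first.
    by move=> p pD; rewrite extend_perm_out.
  congr (_ * _); case: (posnP n) => [n0|n_gt0].
    have -> : zip u r = [::].
      by apply/nilP; rewrite /nilp size_zip sr n0 minn0.
    rewrite big_nil big1 // => j _.
    by have := leq_ltn_trans (leq0n _) (ltn_ord j); rewrite [X in (_ < X)%N]n0.
  have i0 := Ordinal n_gt0.
  rewrite (big_nth (0, iota i0)) size_zip su minnn sr big_mkord.
  apply: eq_bigr => j _; rewrite nth_zip //=.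
  by rewrite (set_nth_default (iota j)) ?sr // rn extend_perm_in.
under eq_bigr do rewrite mulrA.
rewrite -mulr_suml (reindex_inj (mulgI th^-1))%g /=.
have -> : \sum_(h : 'S_n) (-1) ^+ (th^-1 * h)%g *
    (\prod_(j < n) (nth 0 u j * t (iota ((th^-1 * h)%g (th j))))) =
   (-1) ^+ th * alt_form (fun j => nth 0 u (j : 'I_n)) (fun j => t (iota j)).
  rewrite mulr_sumr; apply: eq_bigr => h _.
  rewrite odd_permM odd_permV signr_addb mulrA; congr (_ * _).
  by apply: eq_bigr => j _; rewrite permM permK.
by rewrite F0 mulr0 mul0r.
Qed.

(** * Exchanging the columns of two alternating forms *)

Section Swap.
Variables (R : pzRingType) (n : nat).
Hypothesis alt_form0 : forall v z : 'I_n.+1 -> R, alt_form v z = 0.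

Local Notation T := ('I_n + 'I_n)%type.

Definition on_left (t : T) := if t is inl _ then true else false.

Definition sum_fun (f g : 'I_n -> R) (t : T) : R :=
  match t with inl i => f i | inr i => g i end.

Definition places : seq T :=
  [seq inl i | i <- index_enum 'I_n] ++ [seq inr i | i <- index_enum 'I_n].

Lemma places_uniq : uniq places.
Proof.
rewrite cat_uniq (map_inj_uniq (@inl_inj _ _)) (map_inj_uniq (@inr_inj _ _)).
rewrite index_enum_uniq andbT /=.
by apply/hasPn => _ /mapP[i _ ->]; apply/mapP => -[].
Qed.

Lemma mem_places t : t \in places.
Proof.
by rewrite mem_cat; case: t => i; rewrite map_f ?mem_index_enum ?orbT.
Qed.

Definition word (v w : 'I_n -> R) (t : T -> R) : R :=
  \prod_(p <- places) (sum_fun v w p * t p).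

Lemma wordE v w t :
  word v w t = \prod_(i < n) (v i * t (inl i)) * \prod_(i < n) (w i * t (inr i)).
Proof. by rewrite /word big_cat /= !big_map. Qed.

(* g sends each place to the letter standing there. *)
Definition signed_word v w (t : T -> R) (g : {perm T}) : R :=
  (-1) ^+ g * word v w (fun p => t (g p)).

Definition block_perm (s : 'S_n * 'S_n) : {perm T} :=
  (extend_perm (@inl_inj 'I_n 'I_n) s.1 * extend_perm (@inr_inj 'I_n 'I_n) s.2)%g.

Lemma block_perm_inl s i : block_perm s (inl i) = inl (s.1 i).
Proof.
by rewrite permM extend_perm_in extend_perm_out //; apply/negP => /codomP[].
Qed.

Lemma block_perm_inr s i : block_perm s (inr i) = inr (s.2 i).
Proof.
rewrite permM (extend_perm_out (@inl_inj _ _)) ?extend_perm_in //.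
by apply/negP => /codomP[].
Qed.

(* Interpolates between the block permutations (j = 0) and their composites with
   the exchange of the two sets of letters (j = n). *)
Definition inr_from_left (j : nat) (g : {perm T}) : bool :=
  [forall i : 'I_n, on_left ((g^-1)%g (inr i)) == (i < j)%N].

Lemma inr_from_left0 g :
  inr_from_left 0 g = (g \in [set block_perm s | s in [set: 'S_n * 'S_n]]).
Proof.
apply/forallP/imsetP => [gP|[s _ ->] i]; last first.
  rewrite ltn0; case E: (_ (inr i)) => [k|//].
  by have := block_perm_inl s k; rewrite -E permKV.
have [i|s2 s2E] := @extend_perm_onto _ _ inr (@inr_inj _ _) g^-1%g.
  have := gP i; rewrite ltn0; case: (_ (inr i)) => // k _; exact: codom_f.
have [i|s1 s1E] := @extend_perm_onto _ _ inl (@inl_inj _ _) g^-1%g.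
  case E: (_ (inl i)) => [k|k]; first exact: codom_f.
  by have := s2E ((s2^-1)%g k); rewrite permKV -E => /perm_inj.
exists (s1^-1, s2^-1)%g => //; apply/permP => -[i|i].
  by rewrite block_perm_inl /= -{1}(permKV s1 i) -s1E permKV.
by rewrite block_perm_inr /= -{1}(permKV s2 i) -s2E permKV.
Qed.

Lemma sum_block v w z x :
  \sum_(g | inr_from_left 0 g) signed_word v w (sum_fun z x) g =
  alt_form v z * alt_form w x.
Proof.
rewrite (eq_bigl _ _ inr_from_left0) big_imset /=; last first.
  move=> s1 s2 _ _ e; case: s1 s2 e => [a b] [c d] e; congr (_, _).
    apply/permP => i; apply: (@inl_inj _ 'I_n).
    by rewrite -(block_perm_inl (a, b)) e block_perm_inl.
  apply/permP => i; apply: (@inr_inj 'I_n).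
  by rewrite -(block_perm_inr (a, b)) e block_perm_inr.
rewrite big_distrl /=; under [RHS]eq_bigr do rewrite big_distrr /=.
rewrite pair_bigA /=; apply: eq_big => [s|s _]; first by rewrite inE.
rewrite /signed_word odd_permM !odd_extend_perm mulr_signM.
congr (_ * _); rewrite wordE /=.
by congr (_ * _); apply: eq_bigr => i _; rewrite (block_perm_inl, block_perm_inr).
Qed.

(** Right multiplication permutes the letters. Each coset of the permutations of the [n.+1] letters
    in the image of [iota] contributes an alternation of these letters in a word, which is 0 by
    [alt_word]. *)
Lemma sum_extend0 (K : pred {perm T}) (iota : 'I_n.+1 -> T) v w t :
  injective iota ->
  (forall (g : {perm T}) (iota_inj : injective iota) s,
     K (g * extend_perm iota_inj s)%g = K g) ->
  \sum_(g | K g) signed_word v w t g = 0.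
Proof.
move=> iota_inj KH.
apply: (@sum_coset0 _ _ [group of extend_morphism iota_inj @* setT]%g).
  by move=> g _ /morphimP[s _ _ ->]; exact: KH.
move=> g /=; rewrite morphimEdom big_imset /=; last first.
  by move=> s1 s2 _ _; exact: extend_perm_inj.
have := alt_word (sum_fun v w \o g^-1%g) t iota_inj alt_form0
  (_ : uniq (map g places)).
rewrite (map_inj_uniq (@perm_inj _ g)) places_uniq => /(_ isT) H.
rewrite -[RHS](mulr0 ((-1) ^+ g)) -[X in _ = _ * X]H; last first.
  by move=> p; rewrite -(permKV g p) map_f ?mem_places.
rewrite mulr_sumr; apply: eq_big => [s|s _]; first by rewrite inE.
rewrite /signed_word odd_permM odd_extend_perm signr_addb -mulrA.
congr (_ * (_ * _)); rewrite big_map; apply: eq_bigr => p _ /=.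
by rewrite permK permM.
Qed.

(* The union of the two index sets is invariant under all permutations of the
   n+1 letters inl i and inr j, over which the sum vanishes. *)
Lemma inr_from_leftS v w t (j : 'I_n) :
  \sum_(g | inr_from_left j.+1 g) signed_word v w t g =
  - \sum_(g | inr_from_left j g) signed_word v w t g.
Proof.
pose K (g : {perm T}) :=
  [forall i : 'I_n, (i != j) ==> (on_left ((g^-1)%g (inr i)) == (i < j)%N)].
(* Index 0 is sent to the letter [inr j], whose side [K] leaves free; the other [n] indices
   enumerate the letters [inl i]. *)
pose iota (k : 'I_n.+1) : T := oapp inl (inr j) (unlift ord0 k).
have iota_inj : injective iota.
  move=> a b; rewrite /iota.
  by case: unliftP => [a' ->|->]; case: unliftP => [b' ->|->] //= [->].
have ltS (i : 'I_n) : i != j -> (i < j.+1)%N = (i < j)%N.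
  by rewrite ltnS -val_eqE; case: ltngtP.
apply/eqP; rewrite -subr_eq0 opprK; apply/eqP.
rewrite -[RHS](@sum_extend0 K iota v w t iota_inj); last first.
  move=> g iota_inj' s; apply: eq_forallb => i.
  case: (eqVneq i j) => //= ij; rewrite invMg permM.
  suff -> : ((extend_perm iota_inj' s)^-1)%g (inr i) = inr i by [].
  apply: (@perm_inj _ (extend_perm iota_inj' s)); rewrite permKV extend_perm_out //.
  apply/negP => /codomP[k]; rewrite /iota; case: unliftP => //= _ [] /eqP.
  by rewrite (negPf ij).
rewrite [RHS](bigID (fun g : {perm T} => on_left ((g^-1)%g (inr j)))) /=.
congr (_ + _); apply: eq_bigl => g.
  apply/forallP/andP => [gP|[/forallP gP gj] i].
    split; last by rewrite (eqP (gP j)) ltnSn.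
    apply/forallP => i; apply/implyP => ij; rewrite (eqP (gP i)).
    by rewrite ltS.
  case: (eqVneq i j) => [->|ij]; first by rewrite gj ltnSn.
  by rewrite (eqP (implyP (gP i) ij)) ltS.
apply/forallP/andP => [gP|[/forallP gP gj] i].
  split; last by rewrite (eqP (gP j)) ltnn.
  by apply/forallP => i; apply/implyP => ij; rewrite (eqP (gP i)).
case: (eqVneq i j) => [->|ij]; first by rewrite (negPf gj) ltnn.
by rewrite (eqP (implyP (gP i) ij)).
Qed.

Lemma sum_inr_from_left v w t j : (j <= n)%N ->
  \sum_(g | inr_from_left j g) signed_word v w t g =
  (-1) ^+ j * \sum_(g | inr_from_left 0 g) signed_word v w t g.
Proof.
elim: j => [|j IH] jn; first by rewrite mul1r.
by rewrite (inr_from_leftS _ _ _ (Ordinal jn)) IH 1?ltnW // exprS mulN1r mulNr.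
Qed.

Definition swap_fun (j : nat) (t : T) : T :=
  match t with
  | inl i => if (i < j)%N then inr i else inl i
  | inr i => if (i < j)%N then inl i else inr i
  end.

Lemma swap_funK j : involutive (swap_fun j).
Proof. by case=> i /=; case E: (i < j)%N => /=; rewrite E. Qed.

Definition swap_perm j : {perm T} := perm (inv_inj (swap_funK j)).

Lemma odd_swap_perm j : (j <= n)%N -> swap_perm j = odd j :> bool.
Proof.
elim: j => [|j IH] jn.
  suff -> : swap_perm 0 = 1%g by rewrite odd_perm1.
  by apply/permP => -[i|i]; rewrite permE perm1.
pose k := Ordinal jn.
suff -> : swap_perm j.+1 = (swap_perm j * tperm (inl k) (inr k))%g.
  by rewrite odd_permM IH 1?ltnW // odd_tperm /= addbT.
have ijk (i : 'I_n) : (i < j.+1)%N = (i < j)%N || (i == k).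
  by rewrite ltnS leq_eqVlt orbC -val_eqE.
apply/permP => -[i|i]; rewrite permM ![swap_perm _ _]permE /= ijk.
  case: (eqVneq i k) => [->|ik]; first by rewrite ltnn /= tpermL.
  by rewrite orbF; case: ifP => _; rewrite tpermD //; apply/eqP => -[e]; rewrite e eqxx in ik.
case: (eqVneq i k) => [->|ik]; first by rewrite ltnn /= tpermR.
by rewrite orbF; case: ifP => _; rewrite tpermD //; apply/eqP => -[e]; rewrite e eqxx in ik.
Qed.

Lemma inr_from_leftn g : inr_from_left n (g * swap_perm n)%g = inr_from_left 0 g.
Proof.
have E i : ((g * swap_perm n)^-1)%g (inr i) = (g^-1)%g (inl i).
  rewrite invMg permM; congr (_ _); apply: (@perm_inj _ (swap_perm n)).
  by rewrite permKV permE /= ltn_ord.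
apply/forallP/idP => [gP|].
  have [i|s sE] := @extend_perm_onto _ _ inl (@inl_inj _ _) g^-1%g.
    have := gP i; rewrite E ltn_ord; case: (_ (inl i)) => // k _; exact: codom_f.
  apply/forallP => i; case H: (_ (inr i)) => [k|//].
  by have := sE ((s^-1)%g k); rewrite permKV -H => /perm_inj.
rewrite inr_from_left0 => /imsetP[s _ gE] i; rewrite E ltn_ord gE.
by rewrite -{1}(permKV s.1 i) -block_perm_inl permK.
Qed.

(** Bringing the letters [inr i] to the left one index at a time costs the sign (-1)^n by
    [inr_from_leftS]. Renaming the letters by [swap_perm n] costs the same sign, so the two
    cancel. *)
Lemma alt_form_swap (v w z x : 'I_n -> R) :
  alt_form v z * alt_form w x = alt_form v x * alt_form w z.
Proof.
rewrite -!sum_block; apply: (can_inj (signrMK n)).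
rewrite -sum_inr_from_left // (reindex_inj (mulIg (swap_perm n))) /=.
rewrite mulr_sumr; apply: eq_big => g; first exact: inr_from_leftn.
move=> _.
rewrite /signed_word odd_permM odd_swap_perm // addbC signr_addb signr_odd -mulrA.
congr (_ * (_ * _)); rewrite !wordE.
by congr (_ * _); apply: eq_bigr => i _; congr (_ * _); rewrite permM permE;
   case: (g _) => k /=; rewrite ltn_ord.
Qed.

End Swap.

Lemma eq_alt_form (R : pzRingType) (n : nat) (v v' z z' : 'I_n -> R) :
  v =1 v' -> z =1 z' -> alt_form v z = alt_form v' z'.
Proof.
move=> ev ez; apply: eq_bigr => s _; congr (_ * _).
by apply: eq_bigr => i _; rewrite ev ez.
Qed.

Definition scale_at (R : pzRingType) (n : nat) (a : R) (S : {set 'I_n})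
    (z : 'I_n -> R) : 'I_n -> R :=
  fun i => if i \in S then a * z i else z i.

Definition insert_at (R : pzRingType) (n : nat) (a : R) (S : {set 'I_n})
    (v : 'I_n -> R) : 'I_n -> R :=
  fun i => if i \in S then v i * a else v i.

(* On a determinant f in n columns, this is multiplication by the k-th elementary
   symmetric function of the eigenvalues of a. *)
Definition esym_op (R : pzRingType) (n k : nat) (a : R)
    (f : ('I_n -> R) -> R) (x : 'I_n -> R) : R :=
  \sum_(S : {set 'I_n} | #|S| == k) f (scale_at a S x).

(** * Transfer, commutation and the Cayley-Hamilton identity *)

Section Transfer.
Variables (R : pzRingType) (n : nat).
Implicit Types (a b : R) (v w x z : 'I_n -> R).

(** In the term of [s], the factor [a] before [z (s i)] can be read as standing after [v i]. Summing
    over all [S] of one size makes this relabelling by [s] harmless. *)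
Lemma esym_op_alt_form k a v z :
  esym_op k a (alt_form v) z =
  \sum_(S : {set 'I_n} | #|S| == k) alt_form (insert_at a S v) z.
Proof.
rewrite /esym_op /alt_form exchange_big [RHS]exchange_big /=.
apply: eq_bigr => s _; rewrite -!mulr_sumr; congr (_ * _).
rewrite (reindex_inj (imset_inj (@perm_inj _ s))) /=.
apply: eq_big => [S|S _]; first by rewrite card_imset //; exact: perm_inj.
apply: eq_bigr => i _; rewrite /scale_at /insert_at mem_imset; last exact: perm_inj.
by case: ifP => // _; rewrite mulrA.
Qed.

Hypothesis alt_form0 : forall v z : 'I_n.+1 -> R, alt_form v z = 0.

(** With [a] inserted into [v], the columns can be exchanged without disturbing it. With [a] read on
    the columns again, a second exchange carries it into the other factor. *)
Lemma esym_op_transfer k a v w z x :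
  esym_op k a (alt_form v) z * alt_form w x =
  alt_form v z * esym_op k a (alt_form w) x.
Proof.
transitivity (esym_op k a (alt_form v) x * alt_form w z).
  rewrite !esym_op_alt_form !mulr_suml; apply: eq_bigr => S _.
  exact: alt_form_swap.
rewrite /esym_op mulr_suml mulr_sumr; apply: eq_bigr => S _.
exact: alt_form_swap.
Qed.

Lemma esym_op_mull k a c (f : ('I_n -> R) -> R) x :
  esym_op k a (fun y => c * f y) x = c * esym_op k a f x.
Proof. by rewrite /esym_op mulr_sumr. Qed.

(** The operation by [a] is parked on the left factor. Meanwhile the one by [b] is rewritten as
    insertions into [w], and [a] then returns to act on the columns of the forms so obtained. *)
Lemma esym_opC k l a b v w z x :
  alt_form v z * esym_op l b (esym_op k a (alt_form w)) x =
  alt_form v z * esym_op k a (esym_op l b (alt_form w)) x.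
Proof.
transitivity (esym_op k a (alt_form v) z * esym_op l b (alt_form w) x).
  rewrite [esym_op l b (esym_op _ _ _) _]/esym_op [esym_op l b (alt_form w) x]/esym_op.
  rewrite !mulr_sumr; apply: eq_bigr => S _.
  by apply/esym; apply: esym_op_transfer.
rewrite [esym_op l b _ _]esym_op_alt_form mulr_sumr.
transitivity (\sum_(S : {set 'I_n} | #|S| == l)
    alt_form v z * esym_op k a (alt_form (insert_at b S w)) x).
  by apply: eq_bigr => S _; apply: esym_op_transfer.
rewrite -mulr_sumr /esym_op exchange_big; congr (_ * _).
by apply: eq_bigr => S _; rewrite -esym_op_alt_form.
Qed.

Definition upd (i : 'I_n) (c : R) (z : 'I_n -> R) : 'I_n -> R :=
  fun j => if j == i then c else z j.

Lemma alt_form_fix0 (v z : 'I_n.+1 -> R) :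
  \sum_(s : 'S_n.+1 | s ord0 == ord0) (-1) ^+ s * \prod_(i < n.+1) (v i * z (s i)) =
  v ord0 * z ord0 *
    alt_form (fun i => v (lift ord0 i)) (fun i => z (lift ord0 i)).
Proof.
pose E (s : 'S_n) := extend_perm (@lift_inj _ (@ord0 n)) s.
have E0 s : E s ord0 = ord0.
  rewrite /E extend_perm_out //; apply/negP => /codomP[j] /eqP.
  by rewrite (negPf (neq_lift _ _)).
rewrite (eq_bigl (mem [set E s | s in [set: 'S_n]])); last first.
  move=> s; apply/eqP/imsetP => [s0|[t _ ->]]; last exact: E0.
  have [j|t tE] := @extend_perm_onto _ _ _ (@lift_inj _ (@ord0 n)) s.
    have : ord0 != s (lift ord0 j).
      by rewrite -[X in X != _]s0 (inj_eq perm_inj) neq_lift.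
    by case/unlift_some => k -> _; apply: codom_f.
  exists t => //; apply/permP => i; case: (unliftP ord0 i) => [j ->|->].
    by rewrite tE /E extend_perm_in.
  by rewrite E0.
rewrite big_imset /=; last by move=> s t _ _; exact: extend_perm_inj.
rewrite /alt_form mulr_sumr; apply: eq_big => [s|s _]; first by rewrite inE.
rewrite big_ord_recl E0 odd_extend_perm.
rewrite mulrA -commr_sign -[LHS]mulrA; congr (_ * _).
by congr (_ * _); apply: eq_bigr => i _; rewrite /E extend_perm_in.
Qed.

(** Put a letter 1 in front of both [v] and [z]: the resulting form of size [n.+1] vanishes. Sorting
    its terms by [s ord0] gives [alt_form v z] for the value 0 and the negated terms of the
    right-hand side for the others. *)
Lemma alt_form_cramer v z :
  alt_form v z = \sum_(i < n) z i * alt_form v (upd i 1 z).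
Proof.
pose ext (f : 'I_n -> R) (k : 'I_n.+1) := oapp f 1 (unlift ord0 k).
have := alt_form0 (ext v) (ext z); rewrite {1}/alt_form.
rewrite (partition_big (fun s : 'S_n.+1 => s ord0) predT) //= big_ord_recl.
rewrite alt_form_fix0 /ext unlift_none /= !mul1r.
rewrite (@eq_alt_form _ _ _ v _ z); try by move=> i; rewrite liftK.
move/eqP; rewrite addr_eq0 => /eqP ->; rewrite -sumrN; apply: eq_bigr => i _.
(* The transposition reduces to permutations fixing 0, flips the sign, and exchanges [z i] with the
   added letter 1. This is the source of [upd i 1 z]. *)
rewrite (reindex_inj (mulIg (tperm ord0 (lift ord0 i)))) /=.
rewrite -sumrN (eq_bigl (fun s : 'S_n.+1 => s ord0 == ord0)); last first.
  move=> s; rewrite permM -[X in _ == X](tpermL ord0 (lift ord0 i)).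
  by rewrite (inj_eq perm_inj).
have := alt_form_fix0 (ext v) (fun j => ext z (tperm ord0 (lift ord0 i) j)).
rewrite tpermL /ext unlift_none liftK /= mul1r.
rewrite (@eq_alt_form _ _ _ v _ (upd i 1 z)); first last.
- move=> j; rewrite /upd; case: (eqVneq j i) => [->|ji].
    by rewrite tpermR unlift_none.
  rewrite tpermD ?neq_lift ?liftK // eq_sym (inj_eq lift_inj) //.
- by move=> j; rewrite liftK.
move <-; apply: eq_bigr => s _.
rewrite odd_permM odd_tperm neq_lift /= addbT signrN mulNr opprK.
by congr (_ * _); apply: eq_bigr => j _; rewrite permM.
Qed.

(* By Cramer's rule, the terms for S and i |: S cancel. *)
Lemma alt_form_CH a v z :
  \sum_(S : {set 'I_n}) (-1) ^+ #|S| * a ^+ (n - #|S|) * alt_form v (scale_at a S z)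
  = 0.
Proof.
under eq_bigr do rewrite alt_form_cramer mulr_sumr.
rewrite exchange_big /= big1 // => i _.
rewrite (bigID (fun S : {set 'I_n} => i \in S)) /=.
rewrite (reindex_onto (fun S => i |: S) (fun S => S :\ i)) /=; last first.
  by move=> S iS; rewrite setD1K.
rewrite [X in X + _](eq_bigl (fun S : {set 'I_n} => i \notin S)); last first.
  move=> S; rewrite setU11 /=; apply/eqP/idP => [<-|iS]; first by rewrite setD11.
  by rewrite setU1K.
rewrite -big_split big1 //= => S iS.
(* The exponent of [a] for [S] is therefore positive: one factor [a] matches the [a * z i] of
   [i |: S]. The remaining forms agree, as column [i] is overwritten by 1. *)
have Sn : (#|S| < n)%N.
  rewrite -[X in (_ < X)%N]card_ord -cardsT proper_card // properT.
  by apply: contraNneq iS => ->; rewrite inE.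
rewrite cardsU1 iS add1n /= [scale_at a (i |: S) z i]/scale_at [scale_at a S z i]/scale_at.
rewrite setU11 (negPf iS).
rewrite (@eq_alt_form _ _ v v (upd i 1 (scale_at a (i |: S) z)) (upd i 1 (scale_at a S z))) //.
  by rewrite -(subnSK Sn) [a ^+ _.+1]exprSr [(-1) ^+ _.+1]exprS mulN1r !mulNr !mulrA addNr.
by move=> j; rewrite /upd /scale_at; case: eqVneq => // ji; rewrite !inE (negPf ji).
Qed.

End Transfer.

(** * Alternating forms and Capelli polynomials *)

Lemma word_shift (R : pzRingType) (n : nat) (v : nat -> R) (z : 'I_n -> R) :
  (\prod_(i < n) (v i * z i)) * v n = v 0 * \prod_(i < n) (z i * v i.+1).
Proof.
elim: n v z => [|n IH] v z; first by rewrite !big_ord0 mul1r mulr1.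
rewrite !big_ord_recl /= -!mulrA; congr (_ * (_ * _)).
exact: (IH (fun i => v i.+1) (fun i => z (lift ord0 i))).
Qed.

Lemma alt_form_Cap (R : nzRingType) (n : nat) (v : nat -> R) (z : 'I_n -> R) :
  alt_form (fun i : 'I_n => v i) z * v n = v 0 * Cap z (fun i => v i.+1).
Proof.
rewrite mulr_suml mulr_sumr; apply: eq_bigr => s _.
by rewrite mulrA commr_sign -!mulrA word_shift.
Qed.

Lemma Cap_alt_form (R : nzRingType) (n : nat) (y : 'I_n -> R) :
  exists v e, forall x, Cap x y = alt_form v x * e.
Proof.
(* The leading letter is 1 and [y] is shifted by one place; its last entry is left over as the tail
   [e]. *)
pose v k := if k is j.+1 then oapp y 1 (insub j) else 1.
exists (fun i => v i), (v n) => x; rewrite alt_form_Cap mul1r.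
apply: eq_bigr => s _; congr (_ * _).
by apply: eq_bigr => i _; rewrite /v valK.
Qed.

Lemma Cap0_alt_form0 (R : nzRingType) (n : nat) :
  (forall x y : 'I_n -> R, Cap x y = 0) -> forall v z : 'I_n -> R, alt_form v z = 0.
Proof.
(* The default 1 is the value at [n], so the trailing factor in [alt_form_Cap] disappears. *)
move=> Cap0 v z; pose vn k := oapp v 1 (insub k).
have := alt_form_Cap vn z; rewrite Cap0 mulr0 {2}/vn insubF ?ltnn // mulr1 => <-.
by apply: eq_alt_form => // i; rewrite /vn valK.
Qed.

Lemma mul_alt_form (R : pzRingType) (n : nat) (b : R) (v : 'I_n -> R) :
  (0 < n)%N -> exists v', forall z, b * alt_form v z = alt_form v' z.
Proof.
case: n v => // n v _; exists (fun i => if i == ord0 then b * v i else v i) => z.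
rewrite mulr_sumr; apply: eq_bigr => s _; rewrite mulrA commr_sign -mulrA.
congr (_ * _); rewrite !big_ord_recl eqxx !mulrA; congr (_ * _).
Qed.

(** * The action of A[xi] *)

Section Action.
Variables (R : nzRingType) (n : nat).
Hypothesis n_gt0 : (0 < n)%N.
Hypothesis alt_form0 : forall v z : 'I_n.+1 -> R, alt_form v z = 0.
Local Notation form := (('I_n -> R) -> R).
Implicit Types (f g : form) (c : R) (v w z x : 'I_n -> R).

Inductive alt_span : R -> Prop :=
| alt_span0 : alt_span 0
| alt_spanD (v z : 'I_n -> R) c : alt_span c -> alt_span (alt_form v z + c).

Lemma alt_span_add c d : alt_span c -> alt_span d -> alt_span (c + d).
Proof.
move=> cs ds; elim: cs => [|v z {}c _ IH]; first by rewrite add0r.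
by rewrite -addrA; apply: alt_spanD.
Qed.

Lemma alt_span_mul b c : alt_span c -> alt_span (b * c).
Proof.
elim=> [|v z {}c _ IH]; first by rewrite mulr0; apply: alt_span0.
have [v' v'E] := mul_alt_form b v n_gt0.
by rewrite mulrDr v'E; apply: alt_spanD.
Qed.

Lemma alt_span_form v z : alt_span (alt_form v z).
Proof. by rewrite -[alt_form v z]addr0; apply: alt_spanD; apply: alt_span0. Qed.

(** By transfer the operation moves from [w] to the forms making up [c], where it yields forms
    again. *)
Lemma alt_span_esym_op k a c : alt_span c ->
  exists2 d, alt_span d &
    forall w x, c * esym_op k a (alt_form w) x = d * alt_form w x.
Proof.
elim=> [|v z {}c _ [d ds dE]].
  by exists 0; [exact: alt_span0 | move=> w x; rewrite !mul0r].
exists (esym_op k a (alt_form v) z + d).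
  apply: alt_span_add => //; rewrite /esym_op.
  elim/big_ind: _ => [|c1 c2|S _]; [exact: alt_span0 | exact: alt_span_add |].
  exact: alt_span_form.
by move=> w x; rewrite !mulrDl dE -esym_op_transfer.
Qed.

(** Transfer all operations to the forms in [c]; what remains is [alt_form_CH] with its sets grouped
    by cardinality. *)
Lemma alt_span_CH a c w x : alt_span c ->
  \sum_(k < n.+1)
    (-1) ^+ k * a ^+ (n - k) * (c * esym_op k a (alt_form w) x) = 0.
Proof.
elim=> [|v z {}c _ IH]; first by rewrite big1 // => k _; rewrite mul0r mulr0.
under eq_bigr do rewrite mulrDl mulrDr.
rewrite big_split /= {}IH addr0.
under eq_bigr do rewrite -esym_op_transfer // mulrA.
rewrite -mulr_suml.
suff -> : \sum_(k < n.+1) (-1) ^+ k * a ^+ (n - k) * esym_op k a (alt_form v) z = 0.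
  by rewrite mul0r.
rewrite -[RHS](alt_form_CH alt_form0 a v z).
rewrite [RHS](partition_big (fun S : {set 'I_n} => inord #|S| : 'I_n.+1) predT) //=.
apply: eq_bigr => k _; rewrite mulr_sumr.
have kP (S : {set 'I_n}) : (inord #|S| == k :> 'I_n.+1) = (#|S| == k).
  by rewrite -val_eqE /= inordK // ltnS -[X in (_ <= X)%N]card_ord max_card.
by apply: eq_big => S; rewrite ?kP // => /eqP ->.
Qed.

(** The signed elementary symmetric function, that is, a coefficient of the characteristic
    polynomial of [j.1]. The index [j.2] counts from 0, hence the shift. *)
Definition xi_op (j : R * 'I_n) f : form :=
  fun x => (-1) ^+ j.2.+1 * esym_op j.2.+1 j.1 f x.

(** The functions on which [A[xi]] acts: the left factor from the span is what makes the operations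
    commute. *)
Definition in_span w f : Prop :=
  exists2 c, alt_span c & forall x, f x = c * alt_form w x.

Lemma eq_xi_op j f g : f =1 g -> xi_op j f =1 xi_op j g.
Proof. by move=> e x; congr (_ * _); apply: eq_bigr => S _; rewrite e. Qed.

Lemma xi_op_lin j (I : Type) (r : seq I) (c : I -> R) (f : I -> form) :
  xi_op j (fun x => \sum_(i <- r) c i * f i x) =1
  (fun x => \sum_(i <- r) c i * xi_op j (f i) x).
Proof.
move=> x; rewrite /xi_op /esym_op exchange_big mulr_sumr; apply: eq_bigr => i _.
by rewrite -mulr_sumr [RHS]mulrA [in RHS]commr_sign mulrA.
Qed.

Lemma xi_op_mull j c f : xi_op j (fun x => c * f x) =1 (fun x => c * xi_op j f x).
Proof. by move=> x; rewrite /xi_op esym_op_mull mulrA -commr_sign mulrA. Qed.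

Lemma in_span_xi_op w j f : in_span w f -> in_span w (xi_op j f).
Proof.
case=> c cs fE; have [d ds dE] := alt_span_esym_op j.2.+1 j.1 cs.
exists ((-1) ^+ j.2.+1 * d); first exact: alt_span_mul.
move=> x; rewrite (eq_xi_op j fE) /xi_op esym_op_mull dE mulrA //.
Qed.

Lemma xi_opC w j k f : in_span w f -> xi_op j (xi_op k f) =1 xi_op k (xi_op j f).
Proof.
case=> c cs fE x.
rewrite (eq_xi_op j (eq_xi_op k fE)) (eq_xi_op k (eq_xi_op j fE)).
rewrite (eq_xi_op j (xi_op_mull k c _)) (eq_xi_op k (xi_op_mull j c _)).
rewrite (xi_op_mull j c) (xi_op_mull k c).
have E j' k' : c * xi_op j' (xi_op k' (alt_form w)) x = (-1) ^+ (k'.2.+1 + j'.2.+1) *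
    (c * esym_op j'.2.+1 j'.1 (esym_op k'.2.+1 k'.1 (alt_form w)) x).
  by rewrite /xi_op esym_op_mull [_ ^+ _ * (_ * _)]mulrA -exprD mulrA commr_sign -mulrA addnC.
rewrite !E addnC; congr (_ * _).
elim: cs => [|v z d _ IH]; first by rewrite !mul0r.
by rewrite !mulrDl IH esym_opC.
Qed.

Definition seq_op (s : seq (R * 'I_n)) f : form := foldr xi_op f s.

Lemma in_span_seq_op w s f : in_span w f -> in_span w (seq_op s f).
Proof. by move=> fs; elim: s => //= j s; apply: in_span_xi_op. Qed.

Lemma seq_op_perm w s t f : in_span w f -> perm_eq s t -> seq_op s f =1 seq_op t f.
Proof.
move=> fs; elim: s t => [|j s IH] t st.
  by move: st; rewrite perm_sym => /perm_nilP ->.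
have jt : j \in t by rewrite -(perm_mem st) mem_head.
have [t1 [t2 tE]] : exists t1 t2, t = t1 ++ j :: t2.
  by case: (path.splitPr jt) => t1 t2; exists t1, t2.
rewrite {t jt}tE in st *.
have st' : perm_eq s (t1 ++ t2).
  by rewrite -(perm_cons j) (perm_trans st) // perm_sym -cat1s perm_catCA.
move=> x /=; rewrite (eq_xi_op j (IH _ st')) {IH st st'}.
elim: t1 x => //= k t1 IH x; rewrite (xi_opC _ _ (in_span_seq_op (t1 ++ t2) fs)).
exact: eq_xi_op.
Qed.

Lemma seq_op_lin s (I : Type) (r : seq I) (c : I -> R) (f : I -> form) :
  seq_op s (fun x => \sum_(i <- r) c i * f i x) =1
  (fun x => \sum_(i <- r) c i * seq_op s (f i) x).
Proof.
elim: s => //= j s IH x; rewrite (eq_xi_op j IH); exact: xi_op_lin.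
Qed.

Lemma eq_seq_op s f g : f =1 g -> seq_op s f =1 seq_op s g.
Proof. by move=> e; elim: s => //= j s; apply: eq_xi_op. Qed.

Lemma seq_op0 s : seq_op s (fun=> 0) =1 (fun=> 0).
Proof.
elim: s => //= j s IH x; rewrite (eq_xi_op j IH) /xi_op /esym_op.
by rewrite big1 ?mulr0.
Qed.

(** A monomial is spelled out with multiplicities. The order chosen is immaterial by
    [seq_op_perm]. *)
Definition monom_seq (m : {cmonom (R * 'I_n)%type}) : seq (R * 'I_n) :=
  flatten [seq nseq (m j) j | j <- finmap.finsupp m].

Lemma count_monom_seq m j : count_mem j (monom_seq m) = m j.
Proof.
rewrite /monom_seq.
have : (j \notin (finmap.finsupp m : seq _)) -> m j = 0%N.
  by move=> jm; apply/eqP; rewrite cmE_eq0.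
have : uniq (finmap.finsupp m : seq _) by exact: finmap.fset_uniq.
elim: (finmap.finsupp m : seq _) => [|k r IH] /= => [_ -> //|/andP[kr ur] mj].
rewrite count_cat count_nseq /=; case: (eqVneq k j) => [kj|kj].
  rewrite mul1n -[RHS]addn0 kj; congr (_ + _)%N; apply/count_memPn.
  apply/negP => /flattenP[_ /mapP[i ir ->]]; rewrite mem_nseq => /andP[_ /eqP ji].
  by rewrite kj ji ir in kr.
by rewrite mul0n IH // => jr; apply: mj; rewrite inE eq_sym (negPf kj).
Qed.

Definition monom_op (m : {cmonom (R * 'I_n)%type}) f : form := seq_op (monom_seq m) f.

Lemma monom_opM w m1 m2 f : in_span w f ->
  monom_op (mmul m1 m2) f =1 monom_op m1 (monom_op m2 f).
Proof.
move=> fs x; rewrite /monom_op /seq_op -foldr_cat.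
apply: (seq_op_perm fs); apply/allP => j _ /=.
by rewrite count_cat !count_monom_seq cmM.
Qed.

Lemma monom_op1 f : monom_op mone f = f.
Proof.
suff -> : monom_op mone f = seq_op [::] f by [].
congr seq_op; apply/perm_nilP; apply/allP => j _ /=.
by rewrite count_monom_seq cm1.
Qed.

Lemma monom_opU j f : monom_op (ucm j) f = xi_op j f.
Proof.
suff -> : monom_op (ucm j) f = seq_op [:: j] f by [].
congr seq_op; apply/perm_small_eq => //; apply/allP => k _ /=.
by rewrite count_monom_seq ucmE addn0.
Qed.

Definition act (p : xiAlg R n) f : form := fun x => mmap idfun (fun m => monom_op m f x) p.

Lemma actD p q f x : act (p + q) f x = act p f x + act q f x.
Proof. exact: raddfD. Qed.

Lemma eq_act p f g : f =1 g -> act p f =1 act p g.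
Proof. by move=> e x; apply: eq_bigr => m _; rewrite /monom_op (eq_seq_op _ e). Qed.

Lemma actC c f x : act c%:MP f x = c * f x.
Proof. by rewrite /act mmapU monom_op1. Qed.

Lemma act_xi a i f x : act (xi a i) f x = xi_op (a, i) f x.
Proof. by rewrite /act mmapU monom_opU /= mul1r. Qed.

(** Coefficients of [q] multiply values from the left and so pass through operations on columns;
    monomials compose by [monom_opM]. *)
Lemma actM w p q f : in_span w f -> act (p * q) f =1 act p (act q f).
Proof.
move=> fs x; rewrite malgME /act raddf_sum /= [RHS]mmapE; apply: eq_bigr => m _.
rewrite raddf_sum /= [monom_op m _ x]seq_op_lin mulr_sumr; apply: eq_bigr => k _.
by rewrite mmapU (monom_opM _ _ fs) mulrA.
Qed.

Lemma in_span_act w p f : in_span w f -> in_span w (act p f).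
Proof.
move=> fs; rewrite /act /mmap; elim: (msupp p : seq _) => [|m r [c cs cE]].
  by exists 0; [exact: alt_span0 | move=> x; rewrite big_nil mul0r].
have [d ds dE] := in_span_seq_op (monom_seq m) fs.
exists (p@_m * d + c); first by apply: alt_span_add => //; apply: alt_span_mul.
by move=> x; rewrite big_cons cE [monom_op m f x]dE mulrDl mulrA.
Qed.

Lemma act_xi_poly w a f x : in_span w f -> act (xi_poly n a) f x = 0.
Proof.
move=> fs; have [c cs cE] := fs; rewrite actD actC.
have -> : act (\sum_(i < n) xi a i * (a ^+ (n - i.+1))%:MP) f x =
    \sum_(i < n) a ^+ (n - i.+1) * xi_op (a, i) f x.
  rewrite {1}/act raddf_sum; apply: eq_bigr => i _.
  rewrite -[LHS]/(act _ f x) (actM _ _ fs) act_xi -xi_op_mull.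
  by apply: eq_xi_op => y; rewrite actC.
rewrite -[RHS](alt_span_CH a w x cs) big_ord_recl; congr (_ + _).
  rewrite mul1r subn0 cE /esym_op (big_pred1 set0) => [|S]; last by rewrite cards_eq0.
  by congr (_ * (_ * _)); apply: eq_alt_form => // i; rewrite /scale_at inE.
apply: eq_bigr => i _; rewrite (eq_xi_op _ cE) /xi_op esym_op_mull /=.
by rewrite !mulrA commr_sign.
Qed.

(** * Annihilation by the obstruction ideal *)

(** The induction runs over all [f] at once, since a right factor [a] replaces [f] by [act a f],
    which stays in the span. *)
Lemma ideal_act0 w p f :
  ideal_gen (fun q : xiAlg R n => exists b, q = xi_poly n b) p ->
  in_span w f -> forall x, act p f x = 0.
Proof.
move=> Ip; elim: Ip f => {p} [_ [b ->]||p q _ IHp _ IHq|a p _ IH|p a _ IH] f fs x.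
- exact: act_xi_poly fs.
- exact: raddf0.
- by rewrite actD IHp // IHq // addr0.
- rewrite (actM _ _ fs) (eq_act a (IH f fs)).
  by rewrite /act mmapE big1 // => m _; rewrite /monom_op seq_op0 mulr0.
- by rewrite (actM _ _ fs) IH //; apply: in_span_act.
Qed.

Lemma Obst_alt_form o v z w x : Obst n o -> o * (alt_form v z * alt_form w x) = 0.
Proof.
move=> Io; rewrite -(actC o (fun y => alt_form v z * alt_form w y)).
by apply: (ideal_act0 Io); exists (alt_form v z); first exact: alt_span_form.
Qed.

Lemma Obst_CAP o c1 c2 : Obst n o -> CAP n c1 -> CAP n c2 -> o * c1 * c2 = 0.
Proof.
move=> Io I1 I2.
(* The free factor [e] takes up left multipliers met in the ideal generated by Capelli values, and
   is finally absorbed into a form. The factors [b] and [e] below do the same around [c1]. *)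
have main v z e : o * alt_form v z * e * c2 = 0.
  elim: I2 e => {c2} [_ [x [y ->]]||c d _ IHc _ IHd|a c _ IH|c a _ IH] e.
  - have [w [e' ->]] := Cap_alt_form y; have [w' w'E] := mul_alt_form e w n_gt0.
    by rewrite -mulrA [e * _]mulrA w'E !mulrA -[o * _ * _]mulrA Obst_alt_form // mul0r.
  - by rewrite mulr0.
  - by rewrite mulrDr IHc IHd addr0.
  - by rewrite mulrA -[_ * e * a]mulrA IH.
  - by rewrite mulrA IH mul0r.
suff : forall b e, o * b * c1 * e * c2 = 0.
  by move=> /(_ 1 1); rewrite !mulr1.
elim: I1 => {c1} [_ [x [y ->]]||c d _ IHc _ IHd|a c _ IH|c a _ IH] b e.
- have [w [e' ->]] := Cap_alt_form y; have [w' w'E] := mul_alt_form b w n_gt0.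
  by rewrite -[o * b * _]mulrA [b * _]mulrA w'E !mulrA -[_ * e' * e]mulrA main.
- by rewrite mulr0 !mul0r.
- by rewrite mulrDr !mulrDl IHc IHd addr0.
- by rewrite mulrA -[o * b * a]mulrA IH.
- by rewrite mulrA -[_ * a * e]mulrA IH.
Qed.

End Action.

Theorem theorem2p36 (C : comRingType) (A : algType C) (n : nat) :
  (1 <= n)%N -> affine A ->
  (forall x y : 'I_n.+1 -> A, Cap x y = 0) ->
  forall o c1 c2 : A, Obst n o -> CAP n c1 -> CAP n c2 -> o * c1 * c2 = 0.
Proof.
by move=> n_gt0 _ /Cap0_alt_form0 alt_form0 o c1 c2; apply: Obst_CAP.
Qed.
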